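(* In the $(1:1)$ WMaker--WBreaker Connectivity game on $E(K_n)$ in which WMaker makes the first move (WBreaker is the second player), WBreaker has a strategy ensuring that WMaker needs at least $n$ moves to win, i.e. the edges claimed by WMaker in her first $n-1$ moves do not contain a spanning tree of $K_n$.
   Context: The $(1:1)$ WMaker--WBreaker game on $E(K_n)$: two players, WMaker and WBreaker, alternately claim one edge of the complete graph $K_n$ per turn. Both players are walkers: at her/his first move a player chooses any vertex as starting position; when a player is positioned at a vertex $v$, she/he may only claim an edge incident with $v$ that has not previously been claimed by the opponent, and the other endpoint of the claimed edge becomes her/his new position. In the Connectivity game WMaker wins once her claimed edges contain the edge set of a spanning tree of $K_n$.
   Formalization: The theorem is stated for n ≥ 3: on K_2 WMaker's first move claims the only edge and wins in n−1 = 1 move, and on K_1 the empty edge set is already a spanning tree, so the claim fails for n = 1 and n = 2. *)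

(* Defs.v *)
From mathcomp Require Import all_boot.

Set Implicit Arguments.
Unset Strict Implicit.
Unset Printing Implicit Defensive.

Definition complete_edges (n : nat) : {set {set 'I_n}} :=
  [set e : {set 'I_n} | #|e| == 2].

Definition edge_rel (n : nat) (T : {set {set 'I_n}}) : rel 'I_n :=
  [rel u v | [set u; v] \in T].

(* The bound [2 < size c] excludes [:: u; v], which is a [ucycle] of the
   symmetric relation [edge_rel T] for every edge uv although it is no cycle
   of the graph. *)
Definition acyclic (n : nat) (T : {set {set 'I_n}}) : Prop :=
  forall c : seq 'I_n, 2 < size c -> ~ ucycle (edge_rel T) c.

Definition spanning_tree (n : nat) (T : {set {set 'I_n}}) : Prop :=
  [/\ T \subset complete_edges n,
      forall u v : 'I_n, connect (edge_rel T) u v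
    & acyclic T].

(* The move (u, v) is the step of a walker from u to v, by which she/he claims
   the edge uv. Moving along an edge that the walker already owns is allowed,
   counts as a move, and changes only the position. *)
Definition move (n : nat) : Type := ('I_n * 'I_n)%type.

Definition move_edge (n : nat) (m : move n) : {set 'I_n} := [set m.1; m.2].

Definition claimed (n : nat) (ms : seq (move n)) : {set {set 'I_n}} :=
  [set e in [seq move_edge m | m <- ms]].

(* [own] and [opp] are the earlier moves of the player to move and of the
   opponent, in chronological order. With [own] empty the starting vertex m.1
   is free: choosing it and claiming the first edge form one move. *)
Definition legal_move (n : nat) (own opp : seq (move n)) (m : move n) : bool :=
  [&& move_edge m \in complete_edges n,
      if own is m0 :: ms then m.1 == (last m0 ms).2 else true
    & move_edge m \notin claimed opp].

Definition maker_wins (n : nat) (M : seq (move n)) : Prop :=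
  exists2 T : {set {set 'I_n}}, spanning_tree T & T \subset claimed M.

(* A strategy of WBreaker maps the moves played so far by WMaker and by
   WBreaker to WBreaker's next move. *)
Definition breaker_strategy (n : nat) : Type :=
  seq (move n) -> seq (move n) -> move n.

(* [play s M B]: the moves M of WMaker and B of WBreaker can arise in a game
   that WMaker begins and in which WBreaker follows s. The game stops as soon
   as WMaker has won. *)
Inductive play (n : nat) (s : breaker_strategy n) :
    seq (move n) -> seq (move n) -> Prop :=
| play_start : play s [::] [::]
| play_maker M B m :
    play s M B -> size M = size B -> ~ maker_wins M ->
    legal_move M B m -> play s (rcons M m) B
| play_breaker M B :
    play s M B -> size M = (size B).+1 -> ~ maker_wins M ->
    play s M (rcons B (s M B)).

Definition legal_strategy (n : nat) (s : breaker_strategy n) : Prop :=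
  forall M B : seq (move n),
    play s M B -> size M = (size B).+1 -> ~ maker_wins M ->
    legal_move B M (s M B).

(* Main.v *)
(** WMaker can win within n - 1 moves only by walking along a Hamiltonian path,
    so that each of her moves reaches a new vertex. WBreaker always walks to a
    vertex that WMaker has not visited, if there is one besides his own
    position. Hence, when WMaker has two vertices left, he stands on one of
    them; she walks to one of the two, and he claims the edge between them,
    which is the last edge that she needs. *)
Require Import Defs.
From mathcomp Require Import all_boot.

Set Implicit Arguments.
Unset Strict Implicit.
Unset Printing Implicit Defensive.

Section Game.

Variable n : nat.
Implicit Types (M B : seq (move n)) (m : move n) (s : breaker_strategy n).

Definition visited M : {set 'I_n} := cover (claimed M).

Lemma visited_nil : visited [::] = set0.
Proof. by rewrite /visited /cover big1 // => e; rewrite inE. Qed.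

Lemma claimed_rcons M m : claimed (rcons M m) = move_edge m |: claimed M.
Proof. by apply/setP=> e; rewrite !inE map_rcons mem_rcons inE. Qed.

Lemma disjoint_claimed_rcons M B m :
  [disjoint claimed (rcons M m) & claimed B] =
  (move_edge m \notin claimed B) && [disjoint claimed M & claimed B].
Proof.
by rewrite claimed_rcons -!setI_eq0 setIUl setU_eq0 !setI_eq0 disjoints1.
Qed.

Lemma visited_rcons M m : visited (rcons M m) = move_edge m :|: visited M.
Proof.
rewrite /visited /cover claimed_rcons; apply/setP=> x; rewrite inE.
apply/bigcupP/orP=> [[e]|[xm|/bigcupP[e eM xe]]].
- by rewrite inE => /orP[/set1P-> ->|eM xe]; [left|right; apply/bigcupP; exists e].
- by exists (move_edge m); rewrite // !inE eqxx.
- by exists e; rewrite // inE eM orbT.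
Qed.

Lemma unvisited_unclaimed M (u x : 'I_n) :
  u \notin visited M -> [set x; u] \notin claimed M.
Proof.
apply: contra => eM; apply/bigcupP; exists [set x; u] => //.
by rewrite !inE eqxx orbT.
Qed.

Lemma visited_last m0 M : 0 < size M -> (last m0 M).2 \in visited M.
Proof.
case/lastP: M => // M m _; rewrite last_rcons visited_rcons.
by rewrite !inE eqxx orbT.
Qed.

Lemma visited_move M B m : 0 < size M -> legal_move M B m ->
  visited (rcons M m) = m.2 |: visited M.
Proof.
case: M => // m0 M _ /and3P[_ /eqP m1 _].
have := visited_last m0 (isT : 0 < size (m0 :: M)).
rewrite visited_rcons /move_edge /= -m1 -sub1set => /setUidPr m1M.
by rewrite [[set _; _]]setUC -setUA m1M.
Qed.

(** The two lengths reveal who moved last: WMaker exactly when she is one move ahead. *)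
Lemma play_maker_inv s M B : play s M B -> size M = (size B).+1 ->
  exists M' m, [/\ M = rcons M' m, play s M' B, size M' = size B
                 & legal_move M' B m].
Proof.
case=> [//|M' B' m pl sz _ lm _|M' B' _ -> _].
  by exists M', m.
by rewrite size_rcons => /eqP; rewrite eqn_leq ltnn andbF.
Qed.

Lemma play_breaker_inv s M B : play s M B -> size M = size B -> 0 < size B ->
  exists B', [/\ B = rcons B' (s M B'), play s M B' & size M = (size B').+1].
Proof.
case=> [//|M' B' m _ sz _ _|M' B' pl sz _ _ _].
  by rewrite size_rcons sz => /eqP; rewrite eqn_leq ltnn.
by exists B'.
Qed.

(** The first move accounts for at most two vertices, each later one for at most one more. *)
Lemma card_visited s M B : play s M B -> #|visited M| <= (size M).+1.
Proof.
elim=> [|M' B' m _ IH _ _ lm|//].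
  by rewrite visited_nil cards0.
rewrite size_rcons; case: (posnP (size M')) => [/size0nil M0|M'0].
  by rewrite M0 visited_rcons visited_nil setU0 cards2; case: eqP.
by rewrite (visited_move M'0 lm) cardsU1; case: (_ \notin _); rewrite ?ltnS // leqW.
Qed.

(** Given [u], a path in the tree to some other vertex starts with a claimed edge at [u]. *)
Lemma maker_wins_visited M : 1 < n -> maker_wins M -> visited M = setT.
Proof.
move=> n1 [T [_ conT _] sTM]; apply/setP=> u; rewrite in_setT.
have [v uv] : exists v : 'I_n, v != u.
  apply/existsP; apply: contraTT n1 => /existsPn no.
  rewrite -leqNgt -[n]card_ord; apply/card_le1P => x _ y.
  rewrite !inE; symmetry; apply/eqP.
  by have /negPn/eqP-> := no x; have /negPn/eqP-> := no y.
have /connectP[[|w p] /= pth def] := conT u v; first by rewrite def eqxx in uv.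
case/andP: pth => uw _; apply/bigcupP; exists [set u; w].
  exact: (subsetP sTM).
by rewrite !inE eqxx.
Qed.

(* WBreaker starts at the current position of WMaker; the default [m0] is never
   used, since WMaker has moved before. In the last branch he walks back along
   his own last edge, which WMaker cannot have claimed. *)
Definition chase m0 : breaker_strategy n := fun M B =>
  let l := last (last m0 M) B in
  if [pick u in ~: visited M :\ l.2] is Some u then (l.2, u)
  else if l.2 \notin visited M then (l.2, (last m0 M).2)
  else (l.2, l.1).

Lemma chase_legal m0 M B : 2 < n -> play (chase m0) M B ->
  [disjoint claimed M & claimed B] ->
  (forall b, b \in B -> move_edge b \in complete_edges n) ->
  size M = (size B).+1 -> legal_move B M (chase m0 M B).
Proof.
move=> n2 pl dis edB sz; have M0 : 0 < size M by rewrite sz.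
rewrite /chase; set l := last _ B.
have start : (if B is b :: B' then l.2 == (last b B').2 else true) : bool.
  by rewrite /l; case: (B).
case: pickP => [u|none].
  rewrite !inE => /andP[ul uM]; apply/and3P; split; first 1 last.
  - exact: start.
- exact: unvisited_unclaimed.
- by rewrite /move_edge inE cards2 /= (eq_sym l.2) ul.
case: ifPn => [lM|/negPn lM].
  (* Here [l.2] is unvisited, so WMaker owns no edge at it and does not stand on it. *)
  apply/and3P; split; first 1 last.
  - exact: start.
  - by rewrite /move_edge setUC unvisited_unclaimed.
  - rewrite /move_edge inE cards2 /=; case: (l.2 =P _) => // ll.
    by rewrite ll visited_last in lM.
(* Going back needs an earlier move of WBreaker. Without one, WMaker has moved once and seen at most
   two vertices, yet in this branch every vertex is visited, against [2 < n]. *)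
have B0 : 0 < size B.
  rewrite lt0n; apply: contraTN n2 => /eqP B0; rewrite -leqNgt.
  have := card_visited pl; rewrite sz B0; congr (_ <= 2).
  rewrite -[RHS]card_ord -cardsT; congr #|pred_of_set _|.
  apply/setP=> x; rewrite in_setT.
  have := none x; rewrite !inE; case: eqP => [->|_] /=; first by rewrite lM.
  by move/negbFE.
have lB : l \in B.
  by rewrite /l; case: (B) B0 => // b B' _; apply: (@mem_last ('I_n * 'I_n)%type).
have el : move_edge (l.2, l.1) = move_edge l by rewrite /move_edge setUC.
apply/and3P; split; rewrite ?el; first exact: edB.
  exact: start.
by rewrite (disjointFl dis) // inE map_f.
Qed.

(** These are the invariants that [chase_legal] assumes; legality of each move in turn preserves
    them. *)
Lemma chase_play m0 M B : 2 < n -> play (chase m0) M B ->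
  [disjoint claimed M & claimed B] /\
  (forall b, b \in B -> move_edge b \in complete_edges n).
Proof.
move=> n2; elim=> [|M' B' m pl [dis edB] sz _ lm|M' B' pl [dis edB] sz _].
- by split=> //; apply/pred0P=> e; rewrite /= inE.
- split=> //; case/and3P: lm => _ _ mB.
  by rewrite disjoint_claimed_rcons mB.
- have /and3P[ed _ bM] := chase_legal n2 pl dis edB sz.
  split=> [|b]; last by rewrite mem_rcons inE => /orP[/eqP->|/edB].
  by rewrite disjoint_sym disjoint_claimed_rcons bM disjoint_sym.
Qed.

(** WBreaker can stand on only one of [u] and [u'], so the other is available as a target. *)
Lemma chase_unvisited m0 M B (u u' : 'I_n) : u != u' ->
  u \notin visited M -> u' \notin visited M ->
  (chase m0 M B).2 \notin visited M.
Proof.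
move=> uu' uM u'M; rewrite /chase; set l := last _ B.
case: pickP => [x|none]; first by rewrite !inE => /andP[].
have := none u; have := none u'; rewrite !inE uM u'M !andbT.
by move=> /negbFE/eqP u'l /negbFE/eqP ul; rewrite u'l ul eqxx in uu'.
Qed.

(** From WMaker's position he walks to [z], the only unvisited vertex; from [z] he walks to her
    position. Both moves claim the same edge. *)
Lemma chase_blocks m0 M B (z : 'I_n) :
  0 < size M -> visited M = ~: [set z] ->
  (last (last m0 M) B).2 \in [set (last m0 M).2; z] ->
  move_edge (chase m0 M B) = [set (last m0 M).2; z].
Proof.
move=> M0 visM; have := visited_last m0 M0.
rewrite visM /chase; set l := last _ B; set v := (last m0 M).2.
rewrite in_setC1 => vz /set2P[lv|lz]; case: pickP => [x|none].
- by rewrite visM !inE negbK lv => /andP[_ /eqP->].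
- by have := none z; rewrite visM !inE negbK lv eq_sym vz eqxx.
- by rewrite visM !inE negbK lz => /andP[/negPf->].
- by rewrite visM lz !inE eqxx /move_edge setUC.
Qed.

(** If the bound of [card_visited] is attained after a move, it was attained before, and the move
    reached a new vertex. *)
Lemma maximal_visited_move s M B m : play s M B -> 0 < size M -> legal_move M B m ->
  (size M).+1 < #|visited (rcons M m)| ->
  #|visited M| = (size M).+1 /\ m.2 \notin visited M.
Proof.
move=> pl M0 lm; rewrite (visited_move M0 lm) cardsU1.
have := card_visited pl.
case: (m.2 \in _) => /= le; rewrite ?add0n ?add1n ?ltnS => ge.
  by have := leq_trans ge le; rewrite ltnn.
by split=> //; apply/eqP; rewrite eqn_leq le.
Qed.

Lemma last_edge_claimed m0 M B (z : 'I_n) :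
  play (chase m0) M B -> size M = size B -> 0 < size M ->
  #|visited M| = (size M).+1 -> visited M = ~: [set z] ->
  [set (last m0 M).2; z] \in claimed B.
Proof.
move=> pl sz M0 cM visM.
have [||B' [-> pl' sz']] := play_breaker_inv pl; rewrite -?sz //.
rewrite claimed_rcons -(@chase_blocks m0 M B') ?setU11 //.
(* If this is WBreaker's first move, the default value of [last] puts him at WMaker's position. *)
case: (posnP (size B')) => [/size0nil->|B'0]; first by rewrite set21.
have [M' [m [defM pl'' sz'' lm]]] := play_maker_inv pl' sz'.
have M'0 : 0 < size M' by rewrite sz''.
have [|_ mM'] := maximal_visited_move pl'' M'0 lm.
  by rewrite -defM cM defM size_rcons.
have visM' : m.2 |: visited M' = ~: [set z].
  by rewrite -(visited_move M'0 lm) -defM.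
(* Before WMaker's last move [m], only [m.2] and [z] were unvisited, so WBreaker's preceding move
   led to one of them. *)
have unvis x : x \notin visited M' -> x \in [set m.2; z].
  have /setP/(_ x) := visM'; rewrite !inE.
  by case: (x \in visited M'); rewrite // orbF => ->; case: eqP.
have zM' : (z != m.2) && (z \notin visited M').
  have /setP/(_ z) := visM'; rewrite !inE eqxx /=.
  by move/negbT; rewrite negb_or.
case/andP: zM' => zm zM'.
rewrite {2}defM last_rcons; apply: unvis.
have [||B'' [-> _ _]] := play_breaker_inv pl''; rewrite -?sz'' //.
by rewrite last_rcons; apply: chase_unvisited zm zM' mM'.
Qed.

End Game.

Theorem theorem3 (n : nat) (hn : 2 < n) :
  exists s : breaker_strategy n,
    legal_strategy s /\
    forall M B : seq (move n), play s M B -> maker_wins M -> n <= size M.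
Proof.
have i0 : 'I_n := Ordinal (ltn_trans (isT : 0 < 2) hn).
pose m0 : move n := (i0, i0); exists (chase m0); split=> [M B pl sz _|].
  by have [dis edB] := chase_play hn pl; apply: chase_legal.
move=> M B pl win; have visM := maker_wins_visited (ltnW hn) win.
have cM : #|visited M| = n by rewrite visM cardsT card_ord.
rewrite leqNgt; apply/negP => ltMn.
(* A move of WBreaker leaves [M] unchanged, so only a final move of WMaker remains to be studied. *)
elim: pl win visM cM ltMn => [|M' B' m pl _ sz _ lm|//] _ visM cM ltMn.
  by have := card_visited (play_start (chase m0)); rewrite cM leqNgt (ltnW hn).
have M'0 : 0 < size M'.
  case: (posnP (size M')) => // /size0nil M'nil.
  move: hn; rewrite -cM M'nil visited_rcons visited_nil setU0 cards2.
  by case: eqP.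
have [|cM' mM'] := maximal_visited_move pl M'0 lm.
  by rewrite cM; rewrite size_rcons in ltMn.
have visM' : visited M' = ~: [set m.2].
  apply/setP=> x; have /setP/(_ x) := visM.
  rewrite (visited_move M'0 lm) !inE.
  by case: eqP => [->|_ /= ->//]; rewrite (negPf mM').
(* The final move [m] would have to claim the edge from WMaker's position to [m.2], which WBreaker
   already owns. *)
have := last_edge_claimed pl sz M'0 cM' visM'.
case/and3P: lm => _ m1; rewrite /move_edge.
have -> : m.1 = (last m0 M').2 by case: (M') M'0 m1 => // b M1 _ /eqP.
by move/negPf->.
Qed.
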